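(* Almost all bipartite graphs are not anti-common: the proportion of graphs that are not anti-common, among all bipartite graphs on the labelled vertex set $\{1,\dots,m\}$, tends to $1$ as $m\to\infty$.
   Context: All graphs are finite and simple. An $r$-edge-coloring of a graph is a function from its edge set to $\{1,\dots,r\}$ (not necessarily proper). A subgraph is rainbow if its edges have pairwise distinct colors. A copy of $H$ in $K_n$ is a (not necessarily induced) subgraph of $K_n$ isomorphic to $H$. Let $H$ be a graph with $m$ vertices and $e$ edges. $rb_r(H;n)$ denotes the maximum, over all $r$-edge-colorings of $K_n$, of the number of rainbow copies of $H$ in $K_n$. For $n\ge m$ put $rbC_r(H;n)=\dfrac{rb_r(H;n)}{\binom{n}{m}\frac{m!}{|\mathrm{Aut}(H)|}}$, and let $rbC_r(H)=\lim_{n\to\infty} rbC_r(H;n)$ (this limit exists). For an integer $r\ge m$, $H$ is called $r$-anti-common if $rbC_r(H)=\dfrac{\binom{r}{e}e!}{r^e}$. $H$ is called anti-common if it is $r$-anti-common for all integers $r\ge m$. *)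

(* Defs.v *)
From mathcomp Require Import all_boot all_order all_algebra.
From mathcomp Require Import all_fingroup.
From mathcomp Require Import all_classical all_reals all_analysis.

Set Implicit Arguments.
Unset Strict Implicit.
Unset Printing Implicit Defensive.

Import Order.TTheory GRing.Theory Num.Theory.
Import numFieldNormedType.Exports.

Local Open Scope classical_set_scope.
Local Open Scope ring_scope.

Notation edge T := {e : {set T} | #|e| == 2%N}.

(* A simple graph with vertex set T is given by its edge set, so the graphs
   on the labelled vertex set T form a finite type, and the edges of the
   complete graph on T are all the elements of [edge T]. *)
Notation graph T := {set edge T}.

Section Graphs.

Variable T : finType.
Implicit Types (H : graph T) (x y : T).

Definition adj H x y : bool := [exists e in H, val e == [set x; y]%SET].

Definition bipartite H : bool :=
  [exists A : {set T}, forall x, forall y,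
     adj H x y ==> ((x \in A) != (y \in A))].

Definition graph_aut H : {set {perm T}} :=
  [set s : {perm T} | [forall x, forall y, adj H (s x) (s y) == adj H x y]]%SET.

End Graphs.

Definition coloring (r n : nat) := {ffun edge 'I_n -> 'I_r}.

(* A subgraph of K_n is a pair S of a vertex set and an edge set; the vertex
   set is recorded because H may have isolated vertices. The first conjunct
   says that S is a graph; the second that it is isomorphic to H. *)
Definition is_copy (T : finType) (H : graph T) (n : nat)
    (S : {set 'I_n} * graph 'I_n) : bool :=
  [forall e in S.2, val e \subset S.1] &&
  [exists f : {ffun T -> 'I_n},
     [&& injectiveb f, (f @: [set: T])%SET == S.1 &
         [forall x, forall y, adj S.2 (f x) (f y) == adj H x y]]].

Definition rainbow (r n : nat) (c : coloring r n) (G : graph 'I_n) : bool :=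
  dinjectiveb c (mem G).

Definition rb (r : nat) (T : finType) (H : graph T) (n : nat) : nat :=
  \max_(c : coloring r n)
    #|[pred S : {set 'I_n} * graph 'I_n | is_copy H S & rainbow c S.2]|.

(* For n < #|T| the denominator is 0 and the quotient is 0 by convention;
   this does not affect the limit. *)
Definition rbCn (R : realType) (r : nat) (T : finType) (H : graph T)
    (n : nat) : R :=
  (rb r H n)%:R / ('C(n, #|T|)%:R * (#|T| `!%:R / #|graph_aut H|%:R)).

Definition rbC (R : realType) (r : nat) (T : finType) (H : graph T) : R :=
  limn (rbCn R r H).

Definition r_anti_common (R : realType) (r : nat) (T : finType)
    (H : graph T) : Prop :=
  let e := #|H| in
  rbC R r H = 'C(r, e)%:R * e`!%:R / r%:R ^+ e.

Definition anti_common (R : realType) (T : finType) (H : graph T) : Prop :=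
  forall r : nat, (#|T| <= r)%N -> r_anti_common R r H.

(* Main.v *)
Require Import Defs.
From mathcomp Require Import all_boot all_order all_algebra.
From mathcomp Require Import all_fingroup.
From mathcomp Require Import all_classical all_reals all_analysis.
From mathcomp Require Import zify.

(** The colour number that defeats anti-commonness of a dense graph [H] with
    [m] vertices and [e] edges is [r = e], where the random bound
    [binom(r, e) e! / r^e] is only [e! / e^e].

    Lower bound.  Split the vertices of the complete graph on [m k] vertices
    into [m] parts of size [k], one for each vertex of [H], and give the edges
    between the parts of [x] and [y] a colour of their own whenever [x y] is an
    edge of [H] ([blowup_coloring]).  Choosing one vertex in each part gives
    a rainbow copy of [H], so there are at least [k^m] of them
    ([rb_blowup_ge]), which is a proportion at least [m^-m] of all copies.
    Along the multiples of [m] this bounds the limit from below ([rbC_ge]).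
    As [e! / e^e <= 2^-floor(e/2)] ([fact_half_bound]), [H] is not anti-common
    as soon as [e] exceeds roughly [2 m log m] ([dense_not_anti_common]).

    Counting.  There are only [2^O(m (log m)^2)] graphs with fewer edges than
    that ([card_small_subsets]), against at least [2^floor(m^2/4)] bipartite
    graphs, already among those with a fixed balanced bipartition
    ([card_bipartite_ge]).  So the proportion of anti-common graphs among the
    bipartite ones tends to zero. *)

Set Implicit Arguments.
Unset Strict Implicit.
Unset Printing Implicit Defensive.

Import Order.TTheory GRing.Theory Num.Theory.
Import numFieldNormedType.Exports.

Local Open Scope nat_scope.
Local Open Scope set_scope.

(** * Numerical estimates *)

Lemma ffact_le_exp n m : n ^_ m <= n ^ m.
Proof.
elim: m => [|m IHm] //; rewrite ffactnSr expnSr leq_mul //.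
exact: leq_subr.
Qed.

(** The [e./2] smallest factors of [e!] are at most [e./2], hence each of them
    is at most half of the corresponding factor of [e ^ e]. *)
Lemma fact_half_bound e : e`! * 2 ^ e./2 <= e ^ e.
Proof.
have le_he : e./2 <= e by lia.
rewrite -(ffact_fact (leq_subr e./2 e)) subKn //.
rewrite -[X in _ <= _ ^ X](subnK le_he) expnD -mulnA.
apply: leq_mul; first exact: ffact_le_exp.
rewrite -ffactnn.
apply: leq_trans (leq_mul (ffact_le_exp _ _) (leqnn _)) _.
rewrite -expnMn; case: (posnP e./2) => [->|h_gt0] //.
by rewrite leq_exp2r //; lia.
Qed.

(** * Counting sparse graphs and bipartite graphs *)

(** The number of [k]-subsets is at most [#|E| ^ k], and a sum of these powers
    is dominated by the binomial expansion of [(1 + #|E|) ^ t]. *)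
Lemma card_small_subsets (E : finType) t :
  #|[set A : {set E} | #|A| < t]| <= #|E|.+1 ^ t.
Proof.
rewrite -sum1_card.
(* [inord] loses nothing here: only cardinals below [t] occur. *)
rewrite (partition_big (fun A : {set E} => inord #|A| : 'I_t.+1) xpredT) //=.
rewrite -(add1n #|E|) expnDn; apply: leq_sum => k _.
rewrite exp1n mul1n sum1dep_card.
apply: (@leq_trans ('C(#|E|, k) * (k < t))).
  rewrite -card_draws; case: (ltnP k t) => [_|le_tk]; rewrite ?muln1 ?muln0.
    apply/subset_leq_card/fintype.subsetP => A; rewrite !inE => /andP[At /eqP <-].
    by rewrite inordK // ltnS ltnW.
  rewrite leqn0 cards_eq0; apply/eqP/finset.setP => A; rewrite !inE.
  apply/negP => /andP[At /eqP kA]; move: le_tk; rewrite leqNgt -kA inordK ?At //.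
  by rewrite ltnS ltnW.
case: (ltnP k t) => [kt|_]; rewrite ?muln0 // muln1.
apply: (@leq_trans (#|E| ^ k)).
  rewrite -(leq_pmul2r (fact_gt0 k)) bin_ffact.
  apply: leq_trans (ffact_le_exp _ _) _.
  by rewrite leq_pmulr ?fact_gt0.
by rewrite leq_pmull // bin_gt0 ltnW.
Qed.

Section CompleteBipartite.
Variables (V : finType) (A : {set V}).

Definition crossing : graph V :=
  [set e | [exists a in A, exists b in ~: A, val e == [set a; b]]].

Lemma bipartite_crossing (H : graph V) : H \subset crossing -> bipartite H.
Proof.
move=> /fintype.subsetP HA; apply/existsP; exists A.
apply/forallP => x; apply/forallP => y.
apply/implyP => /exists_inP[e eH /eqP exy].
have := HA e eH.
rewrite inE exy => /exists_inP[a aA /exists_inP[b bA /eqP eq_ab]].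
have : #|[set x; y]| == 2 by rewrite -exy (valP e).
move: bA; rewrite cards2 inE => /negPf bA.
have: x \in [set a; b] by rewrite -eq_ab finset.set21.
have: y \in [set a; b] by rewrite -eq_ab finset.set22.
by rewrite !inE => /orP[] /eqP -> /orP[] /eqP ->; rewrite ?eqxx // aA bA.
Qed.

Lemma card_crossing : #|A| * #|~: A| <= #|crossing|.
Proof.
rewrite -cardsX -[X in _ <= X](card_imset _ val_inj) /=.
rewrite -(@card_in_imset _ _ (fun p => [set p.1; p.2])); last first.
  move=> [a b] [c d]; rewrite !inE /= => /andP[aA bA] /andP[cA dA] eq_ab.
  have: a \in [set c; d] by rewrite -eq_ab finset.set21.
  have: b \in [set c; d] by rewrite -eq_ab finset.set22.
  rewrite !inE => /orP[] /eqP eb /orP[] /eqP ea; subst => //.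
  - by rewrite aA in bA.
  - by rewrite cA in bA.
  - by rewrite aA in dA.
apply/subset_leq_card/fintype.subsetP => e.
move=> /finset.imsetP[[a b] /[!inE] /andP[/= aA bA] ->].
have nab : a != b by apply: contraNneq bA => <-.
have c2 : #|[set a; b]| == 2 by rewrite cards2 nab.
apply/finset.imsetP; exists (Sub [set a; b] c2); rewrite ?SubK // inE SubK.
by apply/exists_inP; exists a => //; apply/exists_inP; exists b; rewrite ?inE.
Qed.

(** Every set of edges crossing the cut [A] is a bipartite graph. *)
Lemma card_bipartite_ge :
  2 ^ (#|A| * #|~: A|) <= #|[pred H : graph V | bipartite H]|.
Proof.
apply: leq_trans (leq_pexp2l _ card_crossing) _ => //.
rewrite -card_powerset; apply/subset_leq_card/fintype.subsetP => H.
by rewrite !inE => /bipartite_crossing.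
Qed.

End CompleteBipartite.

(** * Rainbow copies in a blow-up *)

Section BlowUp.
Variables (T : finType) (H : graph T) (h0 : edge T) (h0H : h0 \in H) (k : nat).
Local Notation n := #|{: T * 'I_k}|.

Definition part (v : 'I_n) : T := (enum_val v).1.

Definition embed (g : {ffun T -> 'I_k}) : {ffun T -> 'I_n} :=
  [ffun t => enum_rank (t, g t)].

Lemma part_embed g t : part (embed g t) = t.
Proof. by rewrite ffunE /part enum_rankK. Qed.

Lemma embed_inj g : injective (embed g).
Proof. exact: can_inj (part_embed g). Qed.

(** An edge lying over an edge of [H] is coloured by the rank of the latter in
    [H].  All other edges, including those inside a part, share the colour of
    [h0]: they belong to no copy that is counted below. *)
Definition blowup_coloring : coloring #|H| n :=
  [ffun e : edge 'I_n => enum_rank_in h0H (insubd h0 (part @: val e)) : 'I_#|H|].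

Definition embed_copy g : {set 'I_n} * graph 'I_n :=
  (embed g @: [set: T],
   [set e : edge 'I_n | [exists h in H, val e == embed g @: val h]]).

Lemma embed_copyP g : is_copy H (embed_copy g).
Proof.
apply/andP; split.
  apply/forall_inP => e /[!inE] /exists_inP[h _ /eqP ->].
  exact/finset.imsetS/finset.subsetT.
apply/existsP; exists (embed g); apply/and3P; split => //.
  exact/injectiveP/embed_inj.
apply/forallP => x; apply/forallP => y; apply/eqP; apply/idP/idP.
  case/exists_inP => e /[!inE] /exists_inP[h hH /eqP eh] /eqP exy.
  apply/exists_inP; exists h => //; apply/eqP/(finset.imset_inj (@embed_inj g)).
  by rewrite -eh exy finset.imsetU1 finset.imset_set1.
case/exists_inP => h hH /eqP hxy.
have c2 : #|embed g @: val h| == 2.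
  by rewrite card_imset ?(valP h) //; exact: embed_inj.
apply/exists_inP; exists (Sub (embed g @: val h) c2); last first.
  by rewrite SubK hxy finset.imsetU1 finset.imset_set1.
by rewrite inE; apply/exists_inP; exists h; rewrite ?SubK.
Qed.

(** The parts recover each edge of [H] from its image under [embed g], so the
    colouring reads off the rank of that edge. *)
Lemma embed_copy_rainbow g : rainbow blowup_coloring (embed_copy g).2.
Proof.
have partK (h : edge T) : part @: (embed g @: val h) = val h.
  rewrite -finset.imset_comp (finset.eq_imset (g := id)) ?finset.imset_id //.
  by move=> t /=; exact: part_embed.
apply/dinjectiveP => e1 e2; rewrite !inE.
move=> /exists_inP[h1 h1H /eqP e1h] /exists_inP[h2 h2H /eqP e2h].
rewrite !ffunE e1h e2h !partK !valKd => /(enum_rank_in_inj h1H h2H) eh.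
by apply: val_inj; rewrite e1h e2h eh.
Qed.

(** The vertex set of the copy is the graph of the function [g]. *)
Lemma embed_copy_inj : injective embed_copy.
Proof.
move=> g1 g2 [/finset.setP eq_im _]; apply/ffunP => t.
have := eq_im (embed g1 t); rewrite finset.imset_f ?inE //.
move=> /esym/finset.imsetP[u _].
by rewrite !ffunE => /enum_rank_inj[-> ->].
Qed.

Lemma rb_blowup_ge : k ^ #|T| <= rb #|H| H n.
Proof.
apply: leq_trans (leq_bigmax blowup_coloring).
rewrite -[X in X ^ _]card_ord -card_ffun -(card_imset _ embed_copy_inj).
apply/subset_leq_card/fintype.subsetP => _ /finset.imsetP[g _ ->].
by rewrite inE /= embed_copyP embed_copy_rainbow.
Qed.

End BlowUp.

Local Open Scope classical_set_scope.
Local Open Scope ring_scope.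

(** * Dense graphs are not anti-common *)

Lemma rbCn_blowup_ge (R : realType) (T : finType) (H : graph T) k :
  (0 < #|H|)%N -> (0 < #|T|)%N -> (0 < k)%N ->
  (#|T| ^ #|T|)%:R^-1 <= rbCn R #|H| H #|{: T * 'I_k}|.
Proof.
move=> /card_gt0P[h0 h0H] T_gt0 k_gt0; rewrite /rbCn.
set n := #|{: T * 'I_k}|.
have nE : n = (#|T| * k)%N by rewrite /n card_prod card_ord.
have aut_gt0 : (0 < #|graph_aut H|)%N.
  apply/card_gt0P; exists 1%g; rewrite inE.
  by apply/forallP => x; apply/forallP => y; rewrite !perm1.
rewrite mulrA -natrM bin_ffact invf_div mulrA ler_pdivlMr; last first.
  by rewrite ltr0n ffact_gt0 nE leq_pmulr.
rewrite mulrC ler_pdivrMr ?ltr0n ?expn_gt0 ?T_gt0 // -!natrM ler_nat.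
apply: leq_trans (ffact_le_exp _ _) _.
have -> : (n ^ #|T| = k ^ #|T| * #|T| ^ #|T|)%N by rewrite nE expnMn mulnC.
rewrite leq_mul2r; apply/orP; right.
apply: leq_trans (rb_blowup_ge h0H k) _.
by rewrite leq_pmulr.
Qed.

(** The blow-up only has [#|T| * k] vertices, but a limit is determined by any
    subsequence. *)
Lemma rbC_ge (R : realType) (T : finType) (H : graph T) :
  (0 < #|H|)%N -> (0 < #|T|)%N -> cvgn (rbCn R #|H| H) ->
  (#|T| ^ #|T|)%:R^-1 <= rbC R #|H| H.
Proof.
move=> H_gt0 T_gt0 cvgH.
have blowup_oo : #|{: T * 'I_k}| @[k --> \oo] --> \oo.
  apply/cvgnyPge => N; exists N => // k /= Nk.
  by rewrite card_prod card_ord (leq_trans Nk) ?leq_pmull.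
have cvgHk : rbCn R #|H| H #|{: T * 'I_k}| @[k --> \oo] --> rbC R #|H| H.
  exact: (cvg_comp _ _ blowup_oo cvgH).
rewrite -(cvg_lim (@Rhausdorff R) cvgHk).
apply: limr_ge; first by apply/cvg_ex; eexists; exact: cvgHk.
by exists 1%N => // k /= k_gt0; exact: rbCn_blowup_ge.
Qed.

(** Take [r = #|H|].  The hypothesis says that the random bound [e! / e^e] is
    smaller than [m^-m]. *)
Lemma not_anti_common (R : realType) (T : finType) (H : graph T) :
  (0 < #|T|)%N -> (#|T| <= #|H|)%N ->
  ((#|H|)`! * #|T| ^ #|T| < #|H| ^ #|H|)%N -> ~ anti_common R H.
Proof.
move=> T_gt0 TH lt_fact /(_ _ TH); rewrite /r_anti_common binn mul1r => rbCE.
have H_gt0 : (0 < #|H|)%N by exact: leq_trans TH.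
have [cvgH|/dvgP] := pselect (cvgn (rbCn R #|H| H)).
  have := rbC_ge H_gt0 T_gt0 cvgH; rewrite rbCE leNgt => /negP; apply.
  rewrite -natrX ltr_pdivrMr ?ltr0n ?expn_gt0 ?H_gt0 //.
  by rewrite mulrC ltr_pdivlMr ?ltr0n ?expn_gt0 ?T_gt0 // -natrM ltr_nat.
(* The operator [lim] has value [0] on a divergent sequence, whereas [e! / e^e]
   is positive: a divergent sequence cannot give an anti-common graph. *)
rewrite -/(rbC R #|H| H) rbCE => /eqP; apply/negP; rewrite -[point]/(0 : R).
by rewrite mulf_neq0 ?invr_neq0 ?expf_neq0 // pnatr_eq0 -lt0n ?fact_gt0.
Qed.

(** With [l = 1 + floor (log2 m)] one has [m ^ m <= 2 ^ (m * l)], so that this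
    many edges make [2 ^ e./2] exceed [m ^ m]. *)
Definition dense_threshold m : nat := (2 * (m * (trunc_log 2 m).+1).+1)%N.

Lemma dense_not_anti_common (R : realType) (T : finType) (H : graph T) :
  (0 < #|T|)%N -> (dense_threshold #|T| <= #|H|)%N -> ~ anti_common R H.
Proof.
rewrite /dense_threshold; set m := #|T|; set l := (trunc_log 2 m).+1.
move=> m_gt0 dense.
have l_gt0 : (0 < l)%N by [].
have le_ml : (m <= m * l)%N by rewrite leq_pmulr.
have half : (m * l < #|H|./2)%N by lia.
apply: not_anti_common => //; first by rewrite -/m; lia.
apply: leq_trans (fact_half_bound _).
rewrite ltn_pmul2l ?fact_gt0 //.
apply: (@leq_ltn_trans (2 ^ (m * l))); last by rewrite ltn_exp2l.
by rewrite mulnC expnM leq_exp2r // ltnW // trunc_log_ltn.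
Qed.

(** * Comparison of the two counts *)

(** The constant 40 leaves room in [threshold_bound], and 13 is the first value
    from which the inequality holds. *)
Lemma sqr_le_exp2 l : (13 <= l -> 40 * l.+1 ^ 2 <= 2 ^ l)%N.
Proof.
move=> le13; rewrite -(subnK le13); elim: (l - 13)%N => [|n IHn] //.
rewrite addSn [(2 ^ _.+1)%N]expnS; apply: leq_trans (leq_mul (leqnn 2) IHn); nia.
Qed.

Lemma card_edge m : (0 < m -> #|{: edge 'I_m}|.+1 <= 2 ^ (2 * (trunc_log 2 m).+1))%N.
Proof.
move=> m_gt0; rewrite card_sig.
have -> : #|[pred e : {set 'I_m} | #|e| == 2]| = 'C(m, 2).
  by rewrite -[in RHS](card_ord m) -card_draws cardsE.
rewrite mulnC expnM.
apply: (@leq_trans (m ^ 2)).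
  by rewrite bin2; nia.
by rewrite leq_exp2r // ltnW // trunc_log_ltn.
Qed.

(** The left-hand side is of order [m (log m)^2]; the right-hand side is the
    number [floor (m^2 / 4)] of edges of the balanced complete bipartite
    graph.  The extra term [m] provides a factor [2 ^ m > m] in the comparison
    of the two families of graphs. *)
Lemma threshold_bound m : (2 ^ 13 <= m)%N ->
  (2 * (trunc_log 2 m).+1 * dense_threshold m + m <= m./2 * (m - m./2))%N.
Proof.
move=> m_large; rewrite /dense_threshold.
have : (40 * (trunc_log 2 m).+1 ^ 2 <= m)%N.
  have m_gt0 : (0 < m)%N by lia.
  apply: leq_trans (trunc_logP (isT : 1 < 2)%N m_gt0).
  exact/sqr_le_exp2/trunc_log_max.
set l := (trunc_log 2 m).+1 => le_l.
have l_le : (l <= l ^ 2)%N by nia.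
have ml_le : (40 * (m * l ^ 2) <= m * m)%N by nia.
have halves : (m * m <= 4 * (m./2 * (m - m./2)) + 1)%N.
  have -> : (m - m./2 = m./2 + odd m)%N by lia.
  by rewrite -{1 2}(odd_double_half m); case: (odd m); nia.
have mm_ge : (2 ^ 13 * m <= m * m)%N by rewrite leq_mul2r m_large orbT.
have -> : (2 * l * (2 * (m * l).+1) = 4 * (m * l ^ 2) + 4 * l)%N by nia.
lia.
Qed.

(** An anti-common graph has fewer than [dense_threshold m] edges, and sparse
    graphs of any kind are already few compared with bipartite graphs. *)
Lemma card_anti_common_bipartite (R : realType) m : (2 ^ 13 <= m)%N ->
  (#|[pred H : graph 'I_m | bipartite H & `[< anti_common R H >]]| * m.+1 <=
   #|[pred H : graph 'I_m | bipartite H]|)%N.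
Proof.
move=> m_large; have m_gt0 : (0 < m)%N by lia.
pose A := (widen_ord (leq_subr (m - m./2) m) @: [set: 'I_(m - (m - m./2))])%SET.
have cardA : #|A| = m./2.
  by rewrite card_imset ?cardsT ?card_ord; [lia|move=> i j [] /val_inj].
have cardAC : #|(~: A)%SET| = (m - m./2)%N.
  by rewrite cardsCs finset.setCK cardA card_ord.
apply: leq_trans (card_bipartite_ge A); rewrite cardA cardAC.
apply: leq_trans (leq_pexp2l _ (threshold_bound m_large)) => //.
rewrite expnD expnM; apply: leq_mul; last exact: ltn_expl.
apply: (@leq_trans (#|{: edge 'I_m}|.+1 ^ dense_threshold m)%N); last first.
  by rewrite leq_exp2r // card_edge.
apply: leq_trans (card_small_subsets _ _).
apply/subset_leq_card/fintype.subsetP => H.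
rewrite !inE => /andP[_ /asboolP antiH].
rewrite ltnNge; apply/negP => dense.
by apply: (@dense_not_anti_common R _ H) antiH; rewrite card_ord.
Qed.

Theorem corollary4p7 (R : realType) :
  (fun m : nat =>
     #|[pred H : graph 'I_m | bipartite H & `[< ~ anti_common R H >]]|%:R
     / #|[pred H : graph 'I_m | bipartite H]|%:R : R) @ \oo --> (1 : R).
Proof.
have cvg1 : (1 - harmonic m : R) @[m --> \oo] --> (1 : R).
  rewrite -[X in _ --> X]subr0; apply: cvgB; [exact: cvg_cst|exact: cvg_harmonic].
apply: (squeeze_cvgr _ cvg1 (cvg_cst _)).
exists (2 ^ 13)%N => // m /= m_large.
set B := #|[pred H : graph 'I_m | bipartite H]|.
have B_gt0 : (0 < B)%N.
  apply: leq_trans (card_bipartite_ge finset.set0).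
  by rewrite expn_gt0.
have := card_anti_common_bipartite R m_large; rewrite -/B.
set N := #|[pred H | _ & `[< ~ _ >]]|; set C := #|[pred H | _ & _]| => le_CB.
have BE : B = (C + N)%N.
  rewrite /B -(cardID [pred H | `[< anti_common R H >]]).
  congr (_ + _)%N; apply: eq_card => H; rewrite !inE //=.
  by rewrite andbC asbool_neg.
rewrite ler_pdivlMr ?ler_pdivrMr ?ltr0n // mul1r ler_nat.
apply/andP; split; last by rewrite BE leq_addl.
rewrite mulrBl mul1r lerBlDr {1}BE natrD addrC lerD2l /harmonic /=.
by rewrite ler_pdivlMl ?ltr0n // mulrC -natrM ler_nat.
Qed.
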